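(* There exists a constant $C>0$ such that the following holds. Let $n,d,r$ be positive integers, let $\epsilon\in(0,1/2]$ and $\delta\in(0,1)$, and let $e_1,\dots,e_n\in\mathbb{R}^d$. Let $P\in\mathbb{R}^{r\times d}$ be a random matrix whose entries are independent with $p_{i,j}\sim\mathcal{N}(0,1/r)$ (Gaussian with mean $0$ and variance $1/r$), and set $z_i=Pe_i\in\mathbb{R}^r$ for $i=1,\dots,n$. If $r\ge C\,\epsilon^{-2}\log(2n/\delta)$, then with probability at least $1-\delta$, $$(1-\epsilon)\,\|e_i-e_j\|\;\le\;\|z_i-z_j\|\;\le\;(1+\epsilon)\,\|e_i-e_j\|\qquad\text{for all } i,j\in\{1,\dots,n\}.$$
   Context: $\|\cdot\|$ denotes the Euclidean ($L^2$) norm. The constant $C$ is absolute, i.e. independent of $n,d,r,\epsilon,\delta$ and of the vectors $e_i$. *)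

(* Defs.v *)
From HB Require Import structures.
From mathcomp Require Import all_boot all_order all_algebra.
From mathcomp Require Import all_classical all_reals all_analysis.

Set Implicit Arguments.
Unset Strict Implicit.
Unset Printing Implicit Defensive.

Import Order.TTheory GRing.Theory Num.Theory.
Import numFieldNormedType.Exports.

Local Open Scope classical_set_scope.
Local Open Scope ring_scope.

(* The canonical norm of MathComp-Analysis on matrices is the sup norm, hence
   this separate Euclidean norm. *)
Definition enorm (R : realType) (m : nat) (x : 'cV[R]_m) : R :=
  Num.sqrt (\sum_(k < m) x k 0 ^+ 2).

(* Mutual (not merely pairwise) independence of a finite family: the product
   rule holds for every subfamily. *)
Definition mutually_independent d d' (T : measurableType d)
    (T' : measurableType d') (R : realType) (P : probability T R)
    (I : finType) (X : I -> {RV P >-> T'}) : Prop :=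
  forall (J : {set I}) (B : I -> set T'),
    (forall i, i \in J -> measurable (B i)) ->
    P (\bigcap_(i in [set` J]) X i @^-1` B i) =
    (\prod_(i in J) P (X i @^-1` B i))%E.

(* Equality of laws is required on Borel sets only, since [normal_prob] carries
   no meaning on other sets. The second argument of [normal_prob] is the
   standard deviation. *)
Definition has_normal_law d (T : measurableType d) (R : realType)
    (P : probability T R) (X : {RV P >-> R}) (m variance : R) : Prop :=
  forall B : set (measurableTypeR R), measurable B ->
    distribution P X B = normal_prob m (Num.sqrt variance) B.

Definition realization d (T : measurableType d) (R : realType)
    (P : probability T R) (r k : nat) (p : 'I_r -> 'I_k -> {RV P >-> R})
    (w : T) : 'M[R]_(r, k) := \matrix_(i, j) p i j w.

(* Main.v *)
(* For a fixed nonzero v, rescaling the coordinates of Pv by sqrt r / |v| gives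
   r independent variables Y_k with E exp(t Y_k) = exp(t^2/2), because the
   moment generating function of a sum of independent variables is a product.
   Hence E exp(l Y_k^2) = (1 - 2l)^(-1/2), and Chernoff's bound for
   sum_k Y_k^2 = r |Pv|^2 / |v|^2 shows that v is distorted by more than a factor
   1 +- eps with probability at most 2 exp(-r eps^2 / 1024).  A union bound over
   the n^2 differences e_i - e_j concludes, with C = 2048. *)
Require Import Defs.
From HB Require Import structures.
From mathcomp Require Import all_boot all_order all_algebra.
From mathcomp Require Import all_classical all_reals all_analysis.
From mathcomp Require Import measurable_realfun.
From mathcomp Require Import ring lra.

Set Implicit Arguments.
Unset Strict Implicit.
Unset Printing Implicit Defensive.

Import Order.TTheory GRing.Theory Num.Theory.
Import numFieldNormedType.Exports.

Local Open Scope classical_set_scope.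
Local Open Scope ring_scope.

(** * Independence *)

(** Rectangles are stable under intersection and generate the product sigma-algebra, so a finite
    measure is determined by its values on them. *)
Lemma measure_rectangles_unique d1 d2 (T1 : measurableType d1)
    (T2 : measurableType d2) (R : realType)
    (m1 m2 : {measure set (T1 * T2) -> \bar R}) :
  (m1 setT < +oo)%E ->
  (forall A B, measurable A -> measurable B -> m1 (A `*` B) = m2 (A `*` B)) ->
  forall X : set (T1 * T2), measurable X -> m1 X = m2 X.
Proof.
move=> m1oo m12 X mX.
pose C : set (set (T1 * T2)) :=
  [set C | exists A, measurable A /\ exists B, measurable B /\ C = A `*` B].
apply: (measure_unique C (fun=> setT)) => //.
- rewrite measurable_prod_measurableType //; congr (<<s _ >>).
  rewrite predeqE; split => [[A mA [B mB <-]]|[A [mA [B [mB ->]]]]].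
    by exists A; split => //; exists B.
  by exists A => //; exists B.
- move=> /= _ _ [X1 [mX1 [X2 [mX2 ->]]]] [Y1 [mY1 [Y2 [mY2 ->]]]].
  rewrite -setXI; exists (X1 `&` Y1); split; first exact: measurableI.
  by exists (X2 `&` Y2); split => //; exact: measurableI.
- by move=> n; exists setT; split => //; exists setT; split => //; rewrite setXTT.
- by rewrite bigcup_const//; exists 0%N.
- by move=> A [A1 [mA1 [A2 [mA2 ->]]]]; exact: m12.
Qed.

Lemma setI_pair_preimage (T T1 T2 : Type) (U : T -> T1) (V : T -> T2) A B :
  (fun w => (U w, V w)) @^-1` (A `*` B) = U @^-1` A `&` V @^-1` B.
Proof. by []. Qed.

Lemma measurable_preim d1 d2 (T1 : measurableType d1) (T2 : measurableType d2)
    (f : T1 -> T2) (B : set T2) :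
  measurable_fun setT f -> measurable B -> measurable (f @^-1` B).
Proof. by move=> mf mB; rewrite -[_ @^-1` _]setTI; exact: mf. Qed.

Section independence.
Context d (T : measurableType d) (R : realType) (P : probability T R).
Local Open Scope ereal_scope.

Definition indep_pair (U V : T -> R) : Prop :=
  forall B C : set R, measurable B -> measurable C ->
    P (U @^-1` B `&` V @^-1` C) = P (U @^-1` B) * P (V @^-1` C).

(** The product rule over the full index set also covers subfamilies: the choice [B i = setT] drops
    the index [i]. Plain functions are used so that sums and compositions fit directly. *)
Definition indep_family (I : finType) (X : I -> T -> R) : Prop :=
  forall B : I -> set R, (forall i, measurable (B i)) ->
    P (\big[setI/setT]_i (X i @^-1` B i)) = \prod_i P (X i @^-1` B i).

(** The law of [(U, V)] restricted to [A] and [q] times the full law agree on rectangles, hence on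
    every Borel set of the plane, in particular on the preimage of [D] under addition. *)
Lemma indep_add (U V : T -> R) (A : set T) (q : \bar R) :
  measurable_fun setT U -> measurable_fun setT V -> measurable A ->
  indep_pair U V ->
  (forall B C : set R, measurable B -> measurable C ->
    P (U @^-1` B `&` (V @^-1` C `&` A)) = P (U @^-1` B) * (P (V @^-1` C) * q)) ->
  forall D : set R, measurable D ->
    P ((U \+ V)%R @^-1` D `&` A) = P ((U \+ V)%R @^-1` D) * q.
Proof.
move=> mU mV mA UV UVA D mD.
(* Taking [B = C = setT] identifies [q], which is therefore finite and nonnegative and can serve as
   a scaling factor for a measure. *)
have qE : q = P A.
  have := UVA setT setT measurableT measurableT.
  by rewrite !preimage_setT !setTI probability_setT !mul1e => ->.
pose W w := (U w, V w).
have mW : measurable_fun setT W by exact: measurable_fun_pair.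
have q0 : (0 <= fine q)%R by rewrite qE fine_ge0.
pose m1 : {measure set _ -> \bar R} := pushforward (mrestr P mA) W.
pose law : {measure set _ -> \bar R} := pushforward P W.
pose m2 : {measure set _ -> \bar R} := mscale (NngNum q0) (law mW).
have qfin : (fine q)%:E = q by rewrite fineK// qE fin_num_measure.
suff /(_ [set z | D (z.1 + z.2)%R]) : forall X, measurable X -> m1 mW X = m2 X.
  rewrite /m2 /m1 /= /mscale /= qfin /pushforward /mrestr /= muleC; apply.
  rewrite -[X in measurable X]setTI.
  by apply: (measurable_funD measurable_fst measurable_snd).
apply: measure_rectangles_unique => [|B C mB mC].
  rewrite /m1 /= /pushforward /mrestr /= (le_lt_trans (probability_le1 _ _)) ?ltry//.
  by rewrite preimage_setT setTI.
rewrite /m2 /m1 /= /mscale /= qfin /pushforward /mrestr /=.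
by rewrite !setI_pair_preimage -setIA UVA// UV// muleA muleC.
Qed.

(** By independence the law of [(U, V)] is the product of the two laws, and Tonelli's theorem
    separates the integrals. *)
Lemma indep_integral (U V : T -> R) (f g : R -> \bar R) :
  measurable_fun setT U -> measurable_fun setT V -> indep_pair U V ->
  measurable_fun setT f -> measurable_fun setT g ->
  (forall x, 0 <= f x) -> (forall x, 0 <= g x) ->
  \int[P]_w (f (U w) * g (V w)) = \int[P]_w f (U w) * \int[P]_w g (V w).
Proof.
move=> mU mV UV mf mg f0 g0.
pose U' : {mfun T >-> R} := HB.pack U (isMeasurableFun.Build _ _ _ _ _ mU).
pose V' : {mfun T >-> R} := HB.pack V (isMeasurableFun.Build _ _ _ _ _ mV).
pose W w := (U w, V w).
have mW : measurable_fun setT W by exact: measurable_fun_pair.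
pose m1 := distribution P U'; pose m2 := distribution P V'.
pose law : {measure set _ -> \bar R} := pushforward P W.
have lawE X : measurable X -> law mW X = (m1 \x m2)%E X.
  apply: measure_rectangles_unique => [|B C mB mC].
    by rewrite /= /pushforward preimage_setT probability_setT ltry.
  rewrite [RHS](product_measure1E m1 m2 mB mC).
  by rewrite /= /pushforward setI_pair_preimage UV.
pose F (z : R * R) := f z.1 * g z.2.
have mF : measurable_fun setT F.
  by apply: emeasurable_funM; apply: measurableT_comp.
have F0 z : 0 <= F z by rewrite mule_ge0.
transitivity (\int[law mW]_z F z).
  by rewrite ge0_integral_pushforward.
rewrite (eq_measure_integral (m1 \x m2)); last by move=> X mX _; exact: lawE.
rewrite fubini_tonelli1// /fubini_F /F /=.
under eq_integral do rewrite ge0_integralZl//.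
rewrite ge0_integralZr//; last exact: integral_ge0.
by rewrite !ge0_integral_pushforward.
Qed.

(* Induction on [s]: the variables are absorbed one at a time into the partial
   sum of their block, the others staying independent of all partial sums. *)
Lemma indep_group (I K : finType) (g : I -> K) (X : I -> T -> R) (s : seq I)
    (B : K -> set R) (C : I -> set R) :
  (forall i, measurable_fun setT (X i)) -> indep_family X -> uniq s ->
  (forall k, measurable (B k)) -> (forall i, measurable (C i)) ->
  let Z k w := (\sum_(i <- s | g i == k) X i w)%R in
  P (\big[setI/setT]_k (Z k @^-1` B k) `&`
     \big[setI/setT]_(i | i \notin s) (X i @^-1` C i)) =
  \prod_k P (Z k @^-1` B k) * \prod_(i | i \notin s) P (X i @^-1` C i).
Proof.
move=> mX indX.
have mZ s' k : measurable_fun setT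
    (fun w => \sum_(i <- s' | g i == k) X i w)%R.
  under eq_fun do rewrite big_mkcond.
  by apply: measurable_sum => i; case: (g i == k) => //.
elim: s B C => [|a s IH] B C /= us mB mC.
  have indC := indX C mC.
  (* All block sums are empty, hence 0: the constraints [B k] hold everywhere if each contains 0;
     otherwise both sides vanish. *)
  have [B0|/existsNP[k Bk0]] := pselect (forall k, B k 0%R).
    rewrite (big1 _ _ (fun k => _ @^-1` B k)); last first.
      move=> k _; apply/seteqP; split => // w _ /=.
      by rewrite big_nil.
    rewrite setTI indC -[LHS]mul1e; congr (_ * _); apply/esym/big1 => k _.
    rewrite [X in P X](_ : _ = setT) ?probability_setT//.
    by apply/seteqP; split => // w _ /=; rewrite big_nil.
  have Z0 : (fun w => \sum_(i <- [::] | g i == k) X i w)%R @^-1` B k = set0.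
    by apply/seteqP; split => // w /=; rewrite big_nil.
  by rewrite (bigD1 k)//= [in RHS](bigD1 k)//= Z0 !set0I !measure0 !mul0e.
move: us => /andP[ans us].
pose k0 := g a.
pose Z k w := (\sum_(i <- s | g i == k) X i w)%R.
have ZE k w : (\sum_(i <- a :: s | g i == k) X i w = 
    if k == k0 then X a w + Z k w else Z k w)%R.
  by rewrite big_cons eq_sym.
have notinE i : (i \notin a :: s) = (i \notin s) && (i != a).
  by rewrite inE negb_or andbC.
(* [A] gathers everything unaffected by moving [a] into its block: the other blocks and the
   variables still outside. *)
pose A := \big[setI/setT]_(k | k != k0) (Z k @^-1` B k) `&`
  \big[setI/setT]_(i | (i \notin s) && (i != a)) (X i @^-1` C i).
pose q := \prod_(k | k != k0) P (Z k @^-1` B k) *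
  \prod_(i | (i \notin s) && (i != a)) P (X i @^-1` C i).
(* The induction hypothesis, with [B] overridden at [k0] and [C] at [a], makes the pair
   [(Z k0, X a)] independent of [A]; [indep_add] then passes to the sum. *)
have H B1 C1 : measurable B1 -> measurable C1 ->
    P (Z k0 @^-1` B1 `&` (X a @^-1` C1 `&` A)) =
    P (Z k0 @^-1` B1) * (P (X a @^-1` C1) * q).
  move=> mB1 mC1.
  pose B' k := if k == k0 then B1 else B k.
  pose C' i := if i == a then C1 else C i.
  have := IH B' C' us; rewrite /= (bigD1 k0)//= (bigD1 a)//=.
  rewrite [in RHS](bigD1 k0)//= [X in _ = _ * X](bigD1 a)//=.
  rewrite /B' /C' !eqxx.
  have mB' k : measurable (if k == k0 then B1 else B k) by case: eqP.
  have mC' i : measurable (if i == a then C1 else C i) by case: eqP.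
  move=> /(_ mB' mC'); rewrite setIACA -setIA muleACA -muleA.
  rewrite (eq_bigr (fun k => Z k @^-1` B k)) => [|k /negPf->//].
  rewrite [\big[setI/setT]_(i | _ && _) _](eq_bigr (fun i => X i @^-1` C i))
    => [|i /andP[_ /negPf->]//].
  rewrite (eq_bigr (fun k => P (Z k @^-1` B k))) => [|k /negPf->//].
  rewrite [\prod_(i | _ && _) _](eq_bigr (fun i => P (X i @^-1` C i)))//.
  by move=> i /andP[_ /negPf->].
have UV : indep_pair (Z k0) (X a).
  move=> B1 C1 mB1 mC1.
  pose B' k := if k == k0 then B1 else setT.
  pose C' i := if i == a then C1 else setT.
  have mB' k : measurable (B' k) by rewrite /B'; case: eqP.
  have mC' i : measurable (C' i) by rewrite /C'; case: eqP.
  have := IH B' C' us mB' mC'; rewrite /= (bigD1 k0)//= (bigD1 a)//=.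
  rewrite [in RHS](bigD1 k0)//= [X in _ = _ * X](bigD1 a)//=.
  rewrite /B' /C' !eqxx.
  rewrite [\big[setI/setT]_(i | i != k0) _]big1 => [|k /negPf->//].
  rewrite [\big[setI/setT]_(i | _ && _) _]big1 => [|i /andP[_ /negPf->]//].
  rewrite !setIT [\prod_(i | i != k0) _]big1; last first.
    by move=> k /negPf ->; rewrite preimage_setT probability_setT.
  rewrite [\prod_(i | _ && _) _]big1 ?mule1//.
  by move=> i /andP[_ /negPf ->]; rewrite preimage_setT probability_setT.
have mA : measurable A.
  by apply: measurableI; apply: bigsetI_measurable => i _; apply: measurable_preim;
    [exact: mZ|exact: mB|exact: mX|exact: mC].
have HD := indep_add (mZ s k0) (mX a) mA UV H (mB k0).
rewrite (bigD1 k0)//= [in RHS](bigD1 k0)//=.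
have -> : (fun w => \sum_(i <- a :: s | g i == k0) X i w)%R = (Z k0 \+ X a)%R.
  by apply/funext => w; rewrite ZE eqxx addrC.
have ZE' k : k != k0 -> (fun w => \sum_(i <- a :: s | g i == k) X i w)%R = Z k.
  by move=> /negPf kk0; apply/funext => w; rewrite ZE kk0.
rewrite (eq_bigr (fun k => Z k @^-1` B k)) => [|k /ZE' ->//].
rewrite [\prod_(k | k != k0) _](eq_bigr (fun k => P (Z k @^-1` B k))) => [|k /ZE' ->//].
rewrite (eq_bigl _ _ notinE) [\prod_(i | i \notin _) _](eq_bigl _ _ notinE).
by rewrite -setIA -muleA.
Qed.

Lemma indep_sum_group (I K : finType) (g : I -> K) (X : I -> T -> R) :
  (forall i, measurable_fun setT (X i)) -> indep_family X ->
  indep_family (fun k w => \sum_(i | g i == k) X i w)%R.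
Proof.
move=> mX indX B mB.
have := indep_group g mX indX (index_enum_uniq I) mB (fun=> measurableT).
rewrite /= [X in _ `&` X]big1 => [|i]; last by rewrite mem_index_enum.
by rewrite setIT [X in _ * X]big1 ?mule1// => i; rewrite mem_index_enum.
Qed.

Lemma indep_comp (I : finType) (X : I -> T -> R) (f : I -> R -> R) :
  (forall i, measurable_fun setT (f i)) -> indep_family X ->
  indep_family (fun i w => f i (X i w)).
Proof.
move=> mf indX B mB; apply: (indX (fun i => f i @^-1` B i)) => i.
exact: measurable_preim (mf i) (mB i).
Qed.

(** Induction on the enumeration: the head is independent of the sum of the tail, by [indep_group]
    with a single block, so [indep_integral] splits off one factor. *)
Lemma integral_expR_sum (I : finType) (X : I -> T -> R) :
  (forall i, measurable_fun setT (X i)) -> indep_family X ->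
  \int[P]_w (expR (\sum_i X i w))%:E = \prod_i \int[P]_w (expR (X i w))%:E.
Proof.
move=> mX indX; have := index_enum_uniq I.
elim: (index_enum I) => [_|a s IH /= /andP[ans us]].
  rewrite big_nil; under eq_integral do rewrite big_nil expR0.
  by rewrite integral_cst//= mul1e probability_setT.
rewrite big_cons -IH//.
pose S w := (\sum_(i <- s) X i w)%R.
have XS : indep_pair (X a) S.
  move=> B C mB mC.
  pose C' i := if i == a then B else setT.
  have mC' i : measurable (C' i) by rewrite /C'; case: eqP.
  have := indep_group (fun=> tt) mX indX us (fun=> mC) mC'.
  rewrite /= !(big_pred1 tt) => [|[]//|[]//].
  rewrite (bigD1 a)//= [X in _ = _ * X](bigD1 a)//= /C' !eqxx.
  rewrite [\big[setI/setT]_(i | _ && _) _]big1 => [|i /andP[_ /negPf->]//].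
  rewrite [\prod_(i | _ && _) _]big1; last first.
    by move=> i /andP[_ /negPf ->]; rewrite preimage_setT probability_setT.
  by rewrite setIT mule1 => h; rewrite setIC muleC; exact: h.
have mE : measurable_fun setT (fun x : R => (expR x)%:E).
  exact/measurable_EFinP.
have mS : measurable_fun setT S by exact: measurable_sum.
have E0 (x : R) : 0 <= (expR x)%:E by rewrite lee_fin expR_ge0.
rewrite -(indep_integral (mX a) mS XS mE mE E0 E0).
by apply: eq_integral => w _; rewrite big_cons expRD EFinM.
Qed.

End independence.

(** * Gaussian integrals *)

Section gaussian_integrals.
Context (R : realType).
Local Open Scope ereal_scope.
Notation mu := (@lebesgue_measure R).

(** The Radon-Nikodym derivative is determined only up to a null set; it equals [normal_pdf] almost
    everywhere because both have the same integral over every measurable set. *)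
Lemma ge0_integral_normal_prob (m s : R) (f : R -> \bar R) :
  measurable_fun setT f -> (forall x, 0 <= f x) ->
  \int[normal_prob m s]_x f x = \int[mu]_x (f x * (normal_pdf m s x)%:E).
Proof.
move=> mf f0.
have dom := normal_prob_dominates m s.
pose h := Radon_Nikodym_SigmaFinite.f (normal_prob m s) mu.
have ih : mu.-integrable setT h := Radon_Nikodym_SigmaFinite.f_integrable dom.
rewrite -(Radon_Nikodym_SigmaFinite.change_of_variables dom)//.
have mpdf : measurable_fun [set: R] (fun x => (normal_pdf m s x)%:E).
  by apply/measurable_EFinP; exact: measurable_normal_pdf.
apply: ae_eq_integral => //.
- by apply: emeasurable_funM => //; exact: measurable_int ih.
- exact: emeasurable_funM.
- apply: ae_eqe_mul2l; apply: integral_ae_eq => // E _ mE.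
  by rewrite -Radon_Nikodym_SigmaFinite.f_integral.
Qed.

(** Completing the square turns the integrand into a constant times the density with mean
    [t * s ^+ 2], whose integral is 1. *)
Lemma normal_prob_mgf (s t : R) : s != 0%R ->
  \int[normal_prob 0 s]_x (expR (t * x))%:E = (expR (t ^+ 2 * s ^+ 2 / 2))%:E.
Proof.
move=> s0; rewrite ge0_integral_normal_prob; last 2 first.
- by apply/measurable_EFinP; apply: measurableT_comp => //; exact: measurable_funM.
- by move=> x; rewrite lee_fin expR_ge0.
under eq_integral.
  move=> x _.
  have -> : (expR (t * x))%:E * (normal_pdf 0 s x)%:E =
      (expR (t ^+ 2 * s ^+ 2 / 2))%:E * (normal_pdf (t * s ^+ 2) s x)%:E.
    rewrite -!EFinM !normal_pdfE// /normal_fun; congr EFin.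
    rewrite mulrCA -expRD [RHS]mulrCA -expRD; congr (_ * expR _)%R.
    by field; rewrite s0.
  over.
rewrite ge0_integralZl//; last 2 first.
- by apply/measurable_EFinP; exact: measurable_normal_pdf.
- by move=> x _; rewrite lee_fin normal_pdf_ge0.
- by rewrite integral_normal_pdf mule1.
Qed.

(** The factor [expR (l * x ^+ 2)] only changes the variance: the integrand is [s] times the centred
    density of variance [s ^+ 2 = 1 / (1 - 2 * l)]. *)
Lemma normal_prob_sqr_mgf (l : R) : (l < 1 / 2)%R ->
  \int[normal_prob 0 1]_x (expR (l * x ^+ 2))%:E =
  ((Num.sqrt (1 - 2 * l))^-1)%R%:E.
Proof.
move=> l2; have c0 : (0 < 1 - 2 * l)%R by lra.
set c := (1 - 2 * l)%R in c0 *; pose s := ((Num.sqrt c)^-1)%R.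
have s0 : s != 0%R by rewrite invr_eq0 gt_eqF// sqrtr_gt0.
have s2 : (s ^+ 2 = c^-1)%R by rewrite exprVn sqr_sqrtr// ltW.
rewrite ge0_integral_normal_prob; last 2 first.
- apply/measurable_EFinP; apply: measurableT_comp => //.
  by apply: measurable_funM => //; exact: measurable_funX.
- by move=> x; rewrite lee_fin expR_ge0.
under eq_integral.
  move=> x _.
  have -> : (expR (l * x ^+ 2))%:E * (normal_pdf 0 1 x)%:E =
      s%:E * (normal_pdf 0 s x)%:E.
    rewrite -!EFinM !normal_pdfE ?oner_eq0// /normal_fun; congr EFin.
    rewrite mulrCA -expRD [RHS]mulrA; congr (_ * expR _)%R.
      rewrite /normal_peak -[in RHS]mulrnAr sqrtrM ?sqr_ge0// sqrtr_sqr.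
      rewrite ger0_norm ?invr_ge0 ?sqrtr_ge0// invfM mulrA divff// mul1r.
      by rewrite expr1n mul1r.
    rewrite s2 subr0 /c; field.
    by rewrite -/c gt_eqF.
  over.
rewrite ge0_integralZl//; last 3 first.
- by apply/measurable_EFinP; exact: measurable_normal_pdf.
- by move=> x _; rewrite lee_fin normal_pdf_ge0.
- by rewrite lee_fin invr_ge0 sqrtr_ge0.
- by rewrite integral_normal_pdf mule1.
Qed.

(* Linearizing the square with an auxiliary Gaussian [g],
   [exp (l Y^2) = E_g exp (sqrt (2 l) g Y)], only the moment generating
   function of [Y] is needed. *)
Lemma integral_expR_sqr d (T : measurableType d) (P : probability T R)
    (Y : T -> R) (l : R) :
  measurable_fun setT Y ->
  (forall t, \int[P]_w (expR (t * Y w))%:E = (expR (t ^+ 2 / 2))%:E) ->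
  (0 <= l)%R -> (l < 1 / 2)%R ->
  \int[P]_w (expR (l * Y w ^+ 2))%:E = ((Num.sqrt (1 - 2 * l))^-1)%R%:E.
Proof.
move=> mY mgfY l0 l2.
pose a := Num.sqrt (2 * l)%R.
have a2 : (a ^+ 2 = 2 * l)%R by rewrite sqr_sqrtr// mulr_ge0.
pose F (z : T * measurableTypeR R) := (expR (a * Y z.1 * z.2))%:E.
have mF : measurable_fun setT F.
  apply/measurable_EFinP; apply: measurableT_comp => //.
  apply: measurable_funM => //; apply: measurable_funM => //.
  exact: measurableT_comp.
(* Integrating out [g] first gives back [expR (l * Y w ^+ 2)]; after the exchange, integrating out
   [w] first leaves the same expression in [g]. *)
transitivity (\int[P]_w \int[normal_prob 0 1]_g F (w, g)).
  apply: eq_integral => w _; rewrite /F/= normal_prob_mgf ?oner_eq0//.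
  by rewrite exprMn a2; congr (expR _)%:E; field.
rewrite fubini_tonelli//; last by move=> z; rewrite lee_fin expR_ge0.
rewrite -normal_prob_sqr_mgf//; apply: eq_integral => g _.
rewrite /F /=; under eq_integral do rewrite mulrAC.
by rewrite mgfY exprMn a2; congr (expR _)%:E; field.
Qed.

End gaussian_integrals.

(** * Tails of sums of squares *)

Section scalar_bounds.
Context (R : realType).
Implicit Types l x : R.

(** After squaring: [(1 + l)^2 (1 - 2l) = 1 - 3l^2 - 2l^3], which is at most 1. *)
Lemma invr_sqrt_ge l : 0 <= l -> l <= 1 / 4 -> 1 + l <= (Num.sqrt (1 - 2 * l))^-1.
Proof.
move=> l0 l4; have c0 : 0 < 1 - 2 * l by lra.
rewrite -[leRHS]mul1r ler_pdivlMr ?sqrtr_gt0//.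
rewrite -ler_sqr ?nnegrE ?mulr_ge0 ?sqrtr_ge0//; last lra.
rewrite exprMn sqr_sqrtr ?(ltW c0)// expr1n; nra.
Qed.

(** After squaring, [1 + x <= expR x] reduces the claim to [(1 + 2l + 8l^2)(1 - 2l) = 1 + 4l^2 (1 -
    4l) >= 1]. *)
Lemma invr_sqrt_le l : 0 <= l -> l <= 1 / 4 ->
  (Num.sqrt (1 - 2 * l))^-1 <= expR (l + 4 * l ^+ 2).
Proof.
move=> l0 l4; have c0 : 0 < 1 - 2 * l by lra.
rewrite -[leLHS]mul1r ler_pdivrMr ?sqrtr_gt0//.
rewrite -ler_sqr ?nnegrE ?mulr_ge0 ?expR_ge0 ?sqrtr_ge0//.
rewrite exprMn sqr_sqrtr ?(ltW c0)// expr1n -expRM_natl.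
have := expR_ge1Dx (2%:R * (l + 4 * l ^+ 2)).
move/(ler_wpM2r (ltW c0)); apply: le_trans; nra.
Qed.

(* Bounds the negative exponential moments of [x] from its positive ones, which
   are all that [integral_expR_sqr] gives. *)
Lemma expRN_le x : 0 <= x -> expR (- x) + expR x <= 2 + x ^+ 2 * expR x.
Proof.
move=> x0; have y0 := expR_gt0 x; have := expR_ge1Dx (- x).
rewrite expRN; set y := expR x in y0 * => h.
have yx : y - 1 <= x * y.
  have := ler_wpM2r (ltW y0) h; rewrite mulVf ?gt_eqF//; lra.
have y1 : 1 <= y by rewrite /y -expR0 ler_expR.
(* Multiplied by [y], the claim becomes [(y - 1)^2 <= (x y)^2], the square of [yx]. *)
rewrite -(ler_pM2r y0) mulrDl mulVf ?gt_eqF//.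
have : (y - 1) ^+ 2 <= (x * y) ^+ 2 by rewrite lerXn2r// nnegrE; lra.
nra.
Qed.

(** In [expRN_le] at [l * x], both [x ^+ 2] and [expR (l * x)] are absorbed by multiples of
    [expR (x / 8)], so one fixed exponential moment controls the remainder for all [l <= 1 / 8]. *)
Lemma expRN_sqr_le l x : 0 <= l -> l <= 1 / 8 -> 0 <= x ->
  expR (- (l * x)) + expR (l * x) <= 2 + 128 * l ^+ 2 * expR (1 / 4 * x).
Proof.
move=> l0 l8 x0; apply: le_trans (expRN_le (mulr_ge0 l0 x0)) _.
(* The quadratic term of the exponential series gives [(x / 8)^2 / 2 <= expR (x / 8)], whence
   128. *)
have := @expR_ge1Dxn R (x / 8) 1; rewrite divr_ge0// => /(_ isT) h.
have hx : x ^+ 2 <= 128 * expR (x / 8).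
  by move: h; rewrite expr_div_n /= (_ : 2`! = 2)%N//; lra.
have -> : 1 / 4 * x = x / 8 + x / 8 by field.
rewrite lerD2l expRD exprMn.
have le8 : expR (l * x) <= expR (x / 8) by rewrite ler_expR; nra.
have -> : 128 * l ^+ 2 * (expR (x / 8) * expR (x / 8)) =
  l ^+ 2 * (128 * expR (x / 8) * expR (x / 8)) by ring.
rewrite -[leLHS]mulrA ler_wpM2l ?sqr_ge0//.
by apply: ler_pM => //; rewrite ?sqr_ge0 ?expR_ge0.
Qed.

End scalar_bounds.

(** * Chi-square tails by Chernoff's method *)

Section chi_square_tails.
Context (R : realType) d (T : measurableType d) (P : probability T R).
Local Open Scope ereal_scope.

(** Integrating [expRN_sqr_le] at [x = Y^2] bounds the moment by [2 + 128 l^2 M(1/4) - M(l)]. Since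
    [M(1/4) <= 2] and [M(l) >= 1 + l], this is at most [1 - l + 256 l^2]. *)
Lemma integral_expRN_sqr (Y : T -> R) (l : R) :
  measurable_fun setT Y ->
  (forall t, \int[P]_w (expR (t * Y w))%:E = (expR (t ^+ 2 / 2))%:E) ->
  (0 <= l)%R -> (l <= 1 / 8)%R ->
  \int[P]_w (expR (- (l * Y w ^+ 2)))%:E <= (expR (- l + 256 * l ^+ 2))%:E.
Proof.
move=> mY mgfY l0 l8.
have mexp c : measurable_fun setT (fun w => (expR (c * Y w ^+ 2))%:E).
  apply/measurable_EFinP; apply: measurableT_comp => //.
  by apply: measurable_funM => //; exact: measurable_funX.
have mexpN : measurable_fun setT (fun w => (expR (- (l * Y w ^+ 2)))%:E).
  by have := mexp (- l)%R; under eq_fun do rewrite mulNr.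
have E0 (x : R) : 0 <= (expR x)%:E by rewrite lee_fin expR_ge0.
pose M (c : R) : R := ((Num.sqrt (1 - 2 * c))^-1)%R.
have ME c : (0 <= c)%R -> (c <= 1 / 4)%R ->
    \int[P]_w (expR (c * Y w ^+ 2))%:E = (M c)%:E.
  by move=> c0 c4; apply: integral_expR_sqr => //; lra.
have H : \int[P]_w (expR (- (l * Y w ^+ 2)))%:E + (M l)%:E <=
    (2 + 128 * l ^+ 2 * M (1 / 4))%:E.
  rewrite -(ME l)//; last lra.
  rewrite -ge0_integralD// EFinD [X in _ <= _ + X]EFinM -ME//.
  rewrite -ge0_integralZl//; last by rewrite lee_fin mulr_ge0 ?sqr_ge0.
  have -> : 2%:E = \int[P]_w (cst 2%:E w).
    by rewrite integral_cst//= probability_setT mule1.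
  rewrite -ge0_integralD//; last 3 first.
  - by move=> w _ /=; rewrite lee_fin.
  - by move=> w _; rewrite mule_ge0// lee_fin mulr_ge0 ?sqr_ge0.
  - exact: emeasurable_funM.
  apply: ge0_le_integral => //.
  - by move=> w _; rewrite adde_ge0.
  - exact: emeasurable_funD.
  - by apply: emeasurable_funD => //; exact: emeasurable_funM.
  - move=> w _; rewrite -!EFinM -!EFinD lee_fin.
    by apply: expRN_sqr_le => //; exact: sqr_ge0.
have M4 : (M (1 / 4) <= 2)%R.
  have c0 : (0 < 1 - 2 * (1 / 4) :> R)%R by lra.
  rewrite /M -[leLHS]mul1r ler_pdivrMr ?sqrtr_gt0//.
  rewrite -ler_sqr ?nnegrE ?mulr_ge0 ?sqrtr_ge0//.
  by rewrite exprMn sqr_sqrtr ?(ltW c0)//; lra.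
rewrite -(@leeD2rE _ (M l)%:E)// (le_trans H)// -EFinD lee_fin.
have := invr_sqrt_ge l0 (_ : l <= 1 / 4)%R; rewrite -/(M l) => Ml.
have := expR_ge1Dx (- l + 256 * l ^+ 2)%R => Ex.
have {Ml} : (1 + l <= M l)%R by apply: Ml; lra.
have : (0 <= l ^+ 2)%R by exact: sqr_ge0.
nra.
Qed.

(** The Chernoff parameter is put into [f], so that [l * x ^+ 2] and its opposite, one for each
    tail, are both instances. *)
Lemma chernoff_sum (I : finType) (X : I -> T -> R) (f : R -> R) (a b : R) :
  (forall i, measurable_fun setT (X i)) -> indep_family P X ->
  measurable_fun setT f ->
  (forall i, \int[P]_w (expR (f (X i w)))%:E <= (expR b)%:E) ->
  P [set w | (a <= \sum_i f (X i w))%R] <= (expR (#|I|%:R * b - a))%:E.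
Proof.
move=> mX indX mf Xb.
have mfX i : measurable_fun setT (fun w => f (X i w)) by exact: measurableT_comp.
pose S w := (\sum_i f (X i w))%R.
have mS : measurable_fun setT S by exact: measurable_sum.
pose S' : {mfun T >-> R} := HB.pack S (isMeasurableFun.Build _ _ _ _ _ mS).
apply: le_trans (chernoff S' a ltr01) _.
rewrite mul1r expRD EFinM lee_wpmul2r ?lee_fin ?expR_ge0//.
rewrite /mmt_gen_fun unlock /=.
under eq_integral do rewrite mulr1.
rewrite integral_expR_sum//; last exact: (@indep_comp _ _ _ _ _ X (fun=> f)).
rewrite expRM_natl -prodr_const -prodEFin.
(* Multiplying inequalities between extended reals requires nonnegative factors, so nonnegativity is
   carried along. *)
apply: (@proj2 (0 <= \prod_i \int[P]_w (expR (f (X i w)))%:E)).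
apply: (big_ind2 (fun x y : \bar R => 0 <= x /\ x <= y)) => [|x x' y y' [? ?] [? ?]|i _].
- by split.
- by split; [exact: mule_ge0|exact: lee_pmul].
- by split => //; apply: integral_ge0 => w _; rewrite lee_fin expR_ge0.
Qed.

Section tails.
Variables (I : finType) (Y : I -> T -> R) (eps : R).
Hypothesis mY : forall i, measurable_fun setT (Y i).
Hypothesis indY : indep_family P Y.
Hypothesis mgfY : forall i t,
  \int[P]_w (expR (t * Y i w))%:E = (expR (t ^+ 2 / 2))%:E.
Hypotheses (eps0 : (0 < eps)%R) (eps1 : (eps <= 1)%R).

(** The parameter [eps / 512] is the best one for the lower tail; it is reused here, where the
    quadratic loss is smaller, to obtain the same bound. *)
Lemma sum_sqr_upper_tail :
  P [set w | (#|I|%:R * (1 + eps) <= \sum_i Y i w ^+ 2)%R] <=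
  (expR (- (#|I|%:R * eps ^+ 2 / 1024)))%:E.
Proof.
move: (eps0) (eps1) => e0 e1.
have [l0 l8] : (0 < eps / 512 /\ eps / 512 <= 1 / 8)%R by split; lra.
set l := (eps / 512)%R in l0 l8.
have mf : measurable_fun setT (fun x : R => l * x ^+ 2)%R.
  by apply: measurable_funM => //; exact: measurable_funX.
have H i : \int[P]_w (expR (l * Y i w ^+ 2))%:E <= (expR (l + 4 * l ^+ 2))%:E.
  by rewrite (integral_expR_sqr (mY i) (mgfY i)) ?lee_fin ?invr_sqrt_le//; lra.
have := chernoff_sum (l * (#|I|%:R * (1 + eps)))%R mY indY mf H.
under eq_set do rewrite -mulr_sumr ler_pM2l//.
move=> /le_trans; apply; rewrite lee_fin ler_expR.
have -> : (#|I|%:R * (l + 4 * l ^+ 2) - l * (#|I|%:R * (1 + eps)) =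
    - (#|I|%:R * (l * eps - 4 * l ^+ 2)))%R by ring.
rewrite lerN2 -mulrA ler_wpM2l// /l; have := sqr_ge0 eps; nra.
Qed.

(** The exponent [l * eps - 256 * l ^+ 2] is maximal at [l = eps / 512], with value
    [eps ^+ 2 / 1024]. *)
Lemma sum_sqr_lower_tail :
  P [set w | (\sum_i Y i w ^+ 2 <= #|I|%:R * (1 - eps))%R] <=
  (expR (- (#|I|%:R * eps ^+ 2 / 1024)))%:E.
Proof.
move: (eps0) (eps1) => e0 e1.
have [l0 l8] : (0 < eps / 512 /\ eps / 512 <= 1 / 8)%R by split; lra.
set l := (eps / 512)%R in l0 l8.
have mf : measurable_fun setT (fun x : R => - (l * x ^+ 2))%R.
  apply: measurableT_comp => //.
  by apply: measurable_funM => //; exact: measurable_funX.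
have H i : \int[P]_w (expR (- (l * Y i w ^+ 2)))%:E <=
    (expR (- l + 256 * l ^+ 2))%:E.
  exact: (integral_expRN_sqr (mY i) (mgfY i) (ltW l0) l8).
have := chernoff_sum (- (l * (#|I|%:R * (1 - eps))))%R mY indY mf H.
under eq_set do rewrite sumrN -mulr_sumr lerN2 ler_pM2l//.
move=> /le_trans; apply; rewrite lee_fin ler_expR.
have -> : (#|I|%:R * (- l + 256 * l ^+ 2) - - (l * (#|I|%:R * (1 - eps))) =
    - (#|I|%:R * (l * eps - 256 * l ^+ 2)))%R by ring.
rewrite lerN2 -mulrA ler_wpM2l// /l; have := sqr_ge0 eps; nra.
Qed.

End tails.
End chi_square_tails.

(** * Random projections *)

Lemma measure_bigsetU_le d (T : measurableType d) (R : realType)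
    (mu : {measure set T -> \bar R}) (I : finType) (F : I -> set T) :
  (forall i, measurable (F i)) ->
  (mu (\big[setU/set0]_i F i) <= \sum_i mu (F i))%E.
Proof.
move=> mF; elim: (index_enum I) => [|i s IH].
  by rewrite !big_nil measure0.
rewrite !big_cons; apply: le_trans (leeD2l _ IH).
by apply: measureU2 => //; exact: bigsetU_measurable.
Qed.

Section enorm.
Context (R : realType).

Lemma enorm_ge0 m (x : 'cV[R]_m) : 0 <= enorm x.
Proof. exact: sqrtr_ge0. Qed.

Lemma sqr_enorm m (x : 'cV[R]_m) : enorm x ^+ 2 = \sum_k x k 0 ^+ 2.
Proof. by rewrite sqr_sqrtr// sumr_ge0// => k _; exact: sqr_ge0. Qed.

Lemma enorm0 m : enorm (0 : 'cV[R]_m) = 0.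
Proof. by rewrite /enorm big1 ?sqrtr0// => k _; rewrite mxE expr0n. Qed.

Lemma enorm_gt0 m (x : 'cV[R]_m) : x != 0 -> 0 < enorm x.
Proof.
move=> x0; rewrite sqrtr_gt0 lt_neqAle eq_sym sumr_ge0 ?andbT//; last first.
  by move=> k _; exact: sqr_ge0.
apply: contra x0 => /eqP s0; apply/eqP/matrixP => k j; rewrite ord1 mxE.
have /psumr_eq0P : forall k, true -> 0 <= x k 0 ^+ 2 by move=> *; exact: sqr_ge0.
by move=> /(_ s0 k isT)/eqP; rewrite sqrf_eq0 => /eqP.
Qed.

End enorm.

Lemma sum_pair_row (V : nmodType) (I J : finType) (k : I) (G : I * J -> V) :
  \sum_(ij | ij.1 == k) G ij = \sum_j G (k, j).
Proof.
rewrite (eq_bigl (fun ij => (ij.1 == k) && true)) => [|ij]; last by rewrite andbT.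
rewrite (eq_bigr (fun ij => G (ij.1, ij.2))) => [|[]//].
by rewrite -(pair_big_dep (pred1 k) (fun _ _ => true) (fun i j => G (i, j)))/=
  big_pred1_eq.
Qed.

(** * Coordinates of the image of a fixed vector *)

Section projection.
Context (R : realType) d (T : measurableType d) (P : probability T R).
Context (r k : nat) (p : 'I_r -> 'I_k -> {RV P >-> R}).
Hypothesis r0 : (0 < r)%N.
Hypothesis lawp : forall i j, has_normal_law (p i j) 0 (1 / r%:R).
Hypothesis indp : mutually_independent (fun ij : 'I_r * 'I_k => p ij.1 ij.2).

Let X (ij : 'I_r * 'I_k) : T -> R := p ij.1 ij.2.

Let mX ij : measurable_fun setT (X ij).
Proof. exact: measurable_funP. Qed.

Let indX : indep_family P X.
Proof.
move=> B mB; have := indp (J := [set: 'I_r * 'I_k]%SET) (fun i _ => mB i).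
have -> : [set` [set: 'I_r * 'I_k]%SET] = [set` index_enum ('I_r * 'I_k)%type].
  by apply/seteqP; split => ij _ /=; rewrite ?inE ?mem_index_enum.
rewrite bigcap_seq => ->; by apply: eq_bigl => ij; rewrite inE.
Qed.

Lemma entry_mgf i j (t : R) :
  (\int[P]_w (expR (t * p i j w))%:E = (expR (t ^+ 2 / (2 * r%:R)))%:E)%E.
Proof.
have rr0 : 0 < r%:R :> R by rewrite ltr0n.
pose f (x : measurableTypeR R) := (expR (t * x))%:E.
have mf : measurable_fun setT f.
  by apply/measurable_EFinP; apply: measurableT_comp => //; exact: measurable_funM.
have f0 x : (0 <= f x)%E by rewrite lee_fin expR_ge0.
(* The same function, with its codomain carrying the Borel structure on which [normal_prob] is
   defined. *)
pose q : T -> measurableTypeR R := p i j.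
have mq : measurable_fun setT q by move=> mT B mB; exact: (mX (i, j)).
pose law : {measure set (measurableTypeR R) -> \bar R} := pushforward P q.
transitivity (\int[law mq]_x f x)%E; first by rewrite ge0_integral_pushforward.
transitivity (\int[normal_prob 0 (Num.sqrt (1 / r%:R))]_x f x)%E.
  by apply: eq_measure_integral => A mA _; exact: lawp.
rewrite normal_prob_mgf ?gt_eqF ?sqrtr_gt0 ?divr_gt0// sqr_sqrtr ?divr_ge0//.
by congr (expR _)%:E; field; rewrite gt_eqF.
Qed.

Context (c : 'I_k -> R).

Let f (ij : 'I_r * 'I_k) (x : R) := c ij.2 * x.

(** This is the [i]-th coordinate of the random matrix applied to the vector [c]. *)
Definition row_comb (i : 'I_r) (w : T) : R := \sum_j c j * p i j w.

Let row_combE : row_comb = fun i w => \sum_(ij | ij.1 == i) f ij (X ij w).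
Proof.
by apply/funext => i; apply/funext => w; rewrite (sum_pair_row _ (fun ij => f ij (X ij w))).
Qed.

Lemma measurable_row_comb i : measurable_fun setT (row_comb i).
Proof. by apply: measurable_sum => j; exact: measurable_funM. Qed.

Lemma indep_row_comb : indep_family P row_comb.
Proof.
rewrite row_combE; apply: (indep_sum_group (fun ij => ij.1)).
  by move=> ij; exact: measurable_funM.
by apply: (@indep_comp _ _ _ _ _ X f) => // ij; exact: measurable_funM.
Qed.

(** The entries contribute exponents [t^2 c_j^2 / (2r)]; the normalization of [c] cancels the
    variance [1 / r]. *)
Lemma row_comb_mgf i (t : R) : \sum_j c j ^+ 2 = r%:R ->
  (\int[P]_w (expR (t * row_comb i w))%:E = (expR (t ^+ 2 / 2))%:E)%E.
Proof.
move=> c2; have rr0 : 0 < r%:R :> R by rewrite ltr0n.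
(* Zero coefficients outside row [i] allow a product over the whole independent family, the extra
   factors being 1. *)
pose g (ij : 'I_r * 'I_k) (x : R) := (if ij.1 == i then t * c ij.2 else 0) * x.
have mg ij : measurable_fun setT (g ij) by exact: measurable_funM.
have -> : (\int[P]_w (expR (t * row_comb i w))%:E =
           \int[P]_w (expR (\sum_ij g ij (X ij w)))%:E)%E.
  apply: eq_integral => w _; congr (expR _)%:E.
  rewrite mulr_sumr -(sum_pair_row i (fun ij => t * (c ij.2 * X ij w))) big_mkcond.
  by apply: eq_bigr => ij _; rewrite /g; case: eqP => _; rewrite ?mul0r// mulrA.
rewrite integral_expR_sum; last 2 first.
- by move=> ij; exact: measurableT_comp.
- exact: indep_comp.
under eq_bigr do rewrite entry_mgf.
rewrite prodEFin -expR_sum; congr (expR _)%:E.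
transitivity (\sum_(ij : 'I_r * 'I_k | ij.1 == i) t ^+ 2 * c ij.2 ^+ 2 / (2 * r%:R)).
  rewrite [RHS]big_mkcond; apply: eq_bigr => ij _.
  by case: eqP => _; rewrite ?exprMn// expr0n !mul0r.
rewrite (sum_pair_row _ (fun ij => t ^+ 2 * c ij.2 ^+ 2 / (2 * r%:R)))/=.
rewrite -mulr_suml -mulr_sumr c2; field.
by rewrite gt_eqF.
Qed.

End projection.

(** * Distortion of a single vector *)

Section distortion.
Context (R : realType) d (T : measurableType d) (P : probability T R).
Context (r k : nat) (p : 'I_r -> 'I_k -> {RV P >-> R}).
Hypothesis r0 : (0 < r)%N.
Hypothesis lawp : forall i j, has_normal_law (p i j) 0 (1 / r%:R).
Hypothesis indp : mutually_independent (fun ij : 'I_r * 'I_k => p ij.1 ij.2).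
Variables (eps : R) (v : 'cV[R]_k).
Hypotheses (eps0 : 0 < eps) (eps1 : eps <= 1).

Definition low_distortion : set T :=
  [set w | (1 - eps) * enorm v <= enorm (realization p w *m v) /\
           enorm (realization p w *m v) <= (1 + eps) * enorm v].

Let S (w : T) := \sum_i row_comb p (fun j => v j 0) i w ^+ 2.

Let SE w : S w = enorm (realization p w *m v) ^+ 2.
Proof.
rewrite sqr_enorm; apply: eq_bigr => i _; congr (_ ^+ 2).
by rewrite !mxE; apply: eq_bigr => j _; rewrite !mxE mulrC.
Qed.

Let low_distortionE : low_distortion =
  S @^-1` [set` `[((1 - eps) * enorm v) ^+ 2, ((1 + eps) * enorm v) ^+ 2]].
Proof.
(* Since [eps <= 1], all compared quantities are nonnegative and squaring preserves the
   inequalities. *)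
have a0 : 0 <= (1 - eps) * enorm v by rewrite mulr_ge0 ?enorm_ge0 ?subr_ge0.
have b0 : 0 <= (1 + eps) * enorm v by rewrite mulr_ge0 ?enorm_ge0 ?addr_ge0 ?ltW.
apply/seteqP; split => w; rewrite /low_distortion /= in_itv /= SE.
  by case=> h1 h2; rewrite !ler_sqr ?nnegrE ?enorm_ge0// h1 h2.
by rewrite !ler_sqr ?nnegrE ?enorm_ge0// => /andP.
Qed.

Lemma measurable_low_distortion : measurable low_distortion.
Proof.
rewrite low_distortionE; apply: measurable_preim; last exact: measurable_itv.
by apply: measurable_sum => i; apply: measurable_funX; exact: measurable_row_comb.
Qed.

Lemma high_distortion_prob :
  (P (~` low_distortion) <= (2 * expR (- (r%:R * eps ^+ 2 / 1024)))%:E)%E.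
Proof.
have mbad := measurableC measurable_low_distortion.
(* The zero vector, which occurs for [i = j], is never distorted but cannot be normalized. *)
have [v0|v0] := eqVneq v 0.
  have -> : ~` low_distortion = set0.
    apply/seteqP; split => // w; apply.
    by rewrite /low_distortion /= v0 mulmx0 !enorm0 !mulr0.
  by rewrite measure0 lee_fin mulr_ge0 ?expR_ge0.
have nv := enorm_gt0 v0.
have rr0 : 0 < r%:R :> R by rewrite ltr0n.
pose a := Num.sqrt r%:R / enorm v.
pose c j := a * v j 0.
have a2 : a ^+ 2 = r%:R / enorm v ^+ 2 by rewrite exprMn sqr_sqrtr ?ler0n// exprVn.
have c2 : \sum_j c j ^+ 2 = r%:R.
  under eq_bigr do rewrite exprMn.
  by rewrite -mulr_sumr -sqr_enorm a2 divfK// gt_eqF// exprn_gt0.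
pose Y := row_comb p c.
have YS w : \sum_i Y i w ^+ 2 = r%:R * (S w / enorm v ^+ 2).
  rewrite mulrCA -a2 mulrC mulr_sumr; apply: eq_bigr => i _; rewrite -exprMn.
  by congr (_ ^+ 2); rewrite mulr_sumr; apply: eq_bigr => j _; rewrite mulrA.
have mY : forall i, measurable_fun setT (Y i) by exact: measurable_row_comb.
have indY : indep_family P Y by exact: indep_row_comb.
have mgfY i t : (\int[P]_w (expR (t * Y i w))%:E = (expR (t ^+ 2 / 2))%:E)%E.
  exact: row_comb_mgf.
have := sum_sqr_upper_tail mY indY mgfY eps0 eps1.
have := sum_sqr_lower_tail mY indY mgfY eps0 eps1.
(* [U] is the event of a too small sum and [L] that of a too large one. *)
rewrite card_ord; set U := [set w | _]; set L := [set w | _] => PU PL.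
have mSY : measurable_fun setT (fun w => \sum_i Y i w ^+ 2).
  by apply: measurable_sum => i; apply: measurable_funX.
have mU : measurable U.
  rewrite (_ : U = (fun w => \sum_i Y i w ^+ 2) @^-1` [set` `]-oo, r%:R * (1 - eps)]]).
    by apply: measurable_preim => //; exact: measurable_itv.
  by apply/seteqP; split => w; rewrite /U /= in_itv.
have mL : measurable L.
  rewrite (_ : L = (fun w => \sum_i Y i w ^+ 2) @^-1` [set` `[r%:R * (1 + eps), +oo[]).
    by apply: measurable_preim => //; exact: measurable_itv.
  by apply/seteqP; split => w; rewrite /L /= in_itv /= andbT.
apply: (@le_trans _ _ (P (U `|` L))).
  apply: le_measure; rewrite ?inE//; first exact: measurableU.
  move=> w; rewrite low_distortionE /= in_itv /= => /negP.
  rewrite negb_and -!ltNge /U /L /= YS !ler_pM2l//.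
  rewrite ler_pdivrMr ?ler_pdivlMr ?exprn_gt0// !exprMn.
  have n2 : 0 < enorm v ^+ 2 by rewrite exprn_gt0.
  move: (eps0) (eps1) => e0 e1.
  (* The tails concern squared norms: [(1 - eps)^2 <= 1 - eps] and [1 + eps <= (1 + eps)^2] place
     the bad event inside them. *)
  case/orP => /ltW h; [left; apply: le_trans h _|right; apply: le_trans h].
    by apply: ler_wpM2r; [exact: ltW|nra].
  by apply: ler_wpM2r; [exact: ltW|nra].
apply: le_trans (measureU2 _ mU mL) _.
by rewrite mulr_natl mulr2n EFinD; apply: leeD.
Qed.

End distortion.

Theorem theorem2 (R : realType) :
  exists C : R, 0 < C /\
  forall (n d r : nat) (eps delta : R) (e : 'I_n -> 'cV[R]_d)
    (disp : measure_display) (T : measurableType disp) (P : probability T R)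
    (p : 'I_r -> 'I_d -> {RV P >-> R}),
  (0 < n)%N -> (0 < d)%N -> (0 < r)%N ->
  0 < eps -> eps <= 1 / 2 ->
  0 < delta -> delta < 1 ->
  (forall i j, has_normal_law (p i j) 0 (1 / r%:R)) ->
  mutually_independent (fun ij : 'I_r * 'I_d => p ij.1 ij.2) ->
  let z (i : 'I_n) (w : T) : 'cV[R]_r := realization p w *m e i in
  C * eps ^- 2 * ln (2 * n%:R / delta) <= r%:R ->
  ((1 - delta)%:E <=
   P [set w | forall i j : 'I_n,
        ((1 - eps) * enorm (e i - e j) <= enorm (z i w - z j w))%R /\
        (enorm (z i w - z j w) <= (1 + eps) * enorm (e i - e j))%R])%E.
Proof.
exists 2048%:R; split; first by rewrite ltr0n.
move=> n d r eps delta e disp T P p n0 _ r0 e0 e2 d0 d1 lawp indp z Cr.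
have e1 : eps <= 1 by lra.
pose F (ij : 'I_n * 'I_n) := ~` low_distortion p eps (e ij.1 - e ij.2).
have mF ij : measurable (F ij).
  by apply: measurableC; exact: measurable_low_distortion.
rewrite [X in P X](_ : _ = ~` \big[setU/set0]_ij F ij); last first.
  have FC i j : ~` F (i, j) = low_distortion p eps (e i - e j) by rewrite /F setCK.
  rewrite -bigcup_seq setC_bigcup; apply/seteqP; split => w H.
    move=> [i j] _; rewrite FC /low_distortion/= mulmxBr; exact: H.
  move=> i j; have : (~` F (i, j)) w by apply: H; rewrite /= mem_index_enum.
  by rewrite FC /low_distortion/= mulmxBr.
rewrite probability_setC; last exact: bigsetU_measurable.
rewrite EFinB leeB//; apply: le_trans (measure_bigsetU_le P mF) _.
pose b := 2 * expR (- (r%:R * eps ^+ 2 / 1024)).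
apply: (@le_trans _ _ (\sum_(ij : 'I_n * 'I_n) b%:E)%E).
  by apply: lee_sum => ij _; exact: high_distortion_prob.
rewrite sumEFin lee_fin sumr_const card_prod card_ord -mulr_natl natrM.
have nr0 : 0 < n%:R :> R by rewrite ltr0n.
set x := 2 * n%:R / delta in Cr.
have x0 : 0 < x by rewrite divr_gt0// mulr_gt0.
(* The factor 2 is [2048 / 1024]; it makes each failure probability at most [2 * x ^- 2], enough to
   beat the [n^2] pairs. *)
have lx : 2 * ln x <= r%:R * eps ^+ 2 / 1024.
  have := ler_wpM2r (sqr_ge0 eps) Cr.
  rewrite mulrAC -(mulrA 2048%:R) mulVf ?mulr1 ?gt_eqF ?exprn_gt0//; lra.
have : b <= 2 * x ^- 2.
  rewrite ler_pM2l// -[x in leRHS]lnK ?posrE// -expRM_natl -expRN ler_expR.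
  by rewrite lerN2.
move=> /(ler_wpM2l (mulr_ge0 (ltW nr0) (ltW nr0)))/le_trans; apply.
(* With [x = 2n / delta] the factors [n] cancel, and [delta^2 / 2 <= delta] remains. *)
have -> : n%:R * n%:R * (2 * x ^- 2) = delta ^+ 2 / 2.
  by rewrite /x; field; rewrite !gt_eqF.
nra.
Qed.
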